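(* Let $(G,\mathcal F)$ be a computational graph with $G=(V,E)$, source set $\mathsf S$, terminal vertex $\Delta$, and $\mathcal F=(f_v)_{v\in V\setminus\mathsf S}$, where every $f_v:\mathbb R^{\mathrm{in}(v)}\to\mathbb R$ is globally Lipschitz. Let $(\mu_s)_{s\in\mathsf S}$ be probability measures on $\mathbb R$ with finite mean, let $(X_s)_{s\in\mathsf S}$ be independent with $X_s\sim\mu_s$, and let $n\in\{1,2,\dots\}$. Let $\mu_s^{(n)}$ denote the quantized input measures, let $\mu_\Delta$ be the output law of the distributional computational graph and let $\mu_\Delta^{(n),c}$ be the output law of the compressed-and-quantized distributional computational graph. Then $$W_1(\mu_\Delta,\mu_\Delta^{(n),c})\le\sum_{s\in\mathsf S}\ \sum_{\gamma\in\mathsf P(s,\Delta)}\left(W_1(\mu_s,\mu_s^{(n)})+\frac{3|\gamma|}{2^n}\,\mathrm{diam}(\mathrm{supp}(\mu_s^{(n)}))\right)\prod_{(u,v)\in\gamma}\|f_v\|_{\mathrm{Lip}}.$$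
   Context: **Computational graph.** $G=(V,E)$ is a finite directed acyclic graph; $(u,v)\in E$ is the edge from $u$ to $v$. $\mathrm{in}(v)=\{u:(u,v)\in E\}$, $\mathrm{out}(v)=\{u:(v,u)\in E\}$. There is a unique terminal vertex $\Delta\in V$ with $\mathrm{in}(\Delta)\ne\emptyset$, $\mathrm{out}(\Delta)=\emptyset$, and such that every vertex has a directed path to $\Delta$. The sources are $\mathsf S=\{v\in V:\mathrm{in}(v)=\emptyset,\ \mathrm{out}(v)\neq\emptyset\}$. $\mathsf P(u,v)$ is the set of directed paths (finite sequences of consecutive edges) from $u$ to $v$, and $|\gamma|$ is the number of edges of $\gamma$. For a finite set $A$, $\mathbb R^A$ is the space of real tuples indexed by $A$, with the $\ell^1$-norm $\|\cdot\|_1$, and for $f:\mathbb R^A\to\mathbb R$, $\|f\|_{\mathrm{Lip}}=\sup_{x\ne y}|f(x)-f(y)|/\|x-y\|_1$. **Wasserstein distance.** $W_1(\mu,\nu)=\inf \mathbb E|X-Y|$ over all couplings $X\sim\mu$, $Y\sim\nu$. **Quantization.** For a probability measure $\mu$ on $\mathbb R$ with finite mean, let $m(\mu)=\int t\,d\mu(t)$. Define $Q_0(\mu)=\delta_{m(\mu)}$ and, for $n\ge1$, with $\Omega_-=\{x<m(\mu)\}$, $\Omega_+=\{x\ge m(\mu)\}$: if $\mu(\Omega_-)>0$ and $\mu(\Omega_+)>0$, put $\mu_\pm=\mu(\,\cdot\,|\,\Omega_\pm)$ and $Q_n(\mu)=\mu(\Omega_+)Q_{n-1}(\mu_+)+\mu(\Omega_-)Q_{n-1}(\mu_-)$;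 otherwise $Q_n(\mu)=\delta_{m(\mu)}$. Write $\mu^{(n)}=Q_n(\mu)$. The recursion partitions $\mathbb R$ into final cells $\Omega_\alpha$ of positive $\mu$-mass; for a random variable $X\sim\mu$, put $Q_n(X)=\sum_\alpha \mathbf 1_{\{X\in\Omega_\alpha\}}\,\mathbb E[X\mid X\in\Omega_\alpha]$, a function of $X$ with law $\mu^{(n)}$. **DCG, qDCG, cqDCG.** Let $(X_s)_{s\in\mathsf S}$ be independent with $X_s\sim\mu_s$. - DCG: $X_v=f_v((X_u)_{u\in\mathrm{in}(v)})$ for $v\notin\mathsf S$; $\mu_v$ is the law of $X_v$. - qDCG: $X_s^{(n)}=Q_n(X_s)$ for $s\in\mathsf S$ and $X_v^{(n)}=f_v((X_u^{(n)})_{u\in\mathrm{in}(v)})$ for $v\notin\mathsf S$; $\mu_v^{(n)}$ is the law of $X_v^{(n)}$. - cqDCG: $X_s^{(n),c}=X_s^{(n)}$ for $s\in\mathsf S$; for $v\notin \mathsf S$, let $Z_v=f_v((X_u^{(n),c})_{u\in\mathrm{in}(v)})$ and set $X_v^{(n),c}=Q_n(Z_v)$ if the law of $Z_v$ has more than $2^n$ atoms, and $X_v^{(n),c}=Z_v$ otherwise; $\mu_v^{(n),c}$ is the law of $X_v^{(n),c}$. *)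

(* Defs.v *)
From HB Require Import structures.
From mathcomp Require Import all_boot all_order all_algebra.
From mathcomp Require Import all_classical all_reals all_analysis.

Set Implicit Arguments.
Unset Strict Implicit.
Unset Printing Implicit Defensive.

Import Order.TTheory GRing.Theory Num.Theory.
Import numFieldNormedType.Exports.

Local Open Scope classical_set_scope.
Local Open Scope ring_scope.

Section graph.
Variables (V : finType) (E : rel V).

Definition in_nbr (v : V) : {set V} := [set u | E u v]%SET.
Definition out_nbr (v : V) : {set V} := [set u | E v u]%SET.

Definition acyclic : Prop :=
  forall (v : V) (p : seq V), path E v p -> last v p = v -> p = [::].

Definition terminal (v : V) : Prop :=
  [/\ in_nbr v != finset.set0, out_nbr v = finset.set0 &
      forall u : V, connect E u v].

Definition computational_graph (Delta : V) : Prop :=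
  acyclic /\ unique terminal Delta.

Definition sources : {set V} :=
  [set v | (in_nbr v == finset.set0) && (out_nbr v != finset.set0)]%SET.

(* A directed path u -> v_1 -> ... -> v_k = v is encoded, as in [path], by its
   source u and the sequence [:: v_1; ...; v_k]; it has k edges. *)
Definition dipaths (u v : V) : set (seq V) :=
  [set p | path E u p /\ last u p = v].

Definition path_edges (u : V) (p : seq V) : seq (V * V) := zip (u :: p) p.

Lemma acyclic_wf : acyclic -> well_founded (fun u v => E u v).
Proof.
move=> acE.
pose rk (v : V) := #|[pred u | connect E u v]|.
suff lt_rk u v : E u v -> (rk u < rk v)%N.
  suff acc_rk k v : (rk v < k)%N -> Acc (fun u v => E u v) v.
    by move=> v; exact: (acc_rk (rk v).+1).
  elim: k v => [v|k IHk v lekv]; first by rewrite ltn0.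
  constructor=> u Euv; apply: IHk; exact: leq_trans (lt_rk _ _ Euv) lekv.
move=> Euv; apply/proper_card/properP; split.
  apply/fintype.subsetP => w; rewrite !inE => cwu.
  exact: connect_trans cwu (connect1 Euv).
exists v; rewrite inE ?connect0//; apply/negP => /connectP[p vp ulast].
have := acE u (v :: p).
by rewrite /= Euv vp -ulast => /(_ isT erefl).
Qed.

Lemma acyclic_rec (A : Type) (g : forall v, ({u | u \in in_nbr v} -> A) -> A) :
  acyclic -> exists Y : V -> A, forall v, Y v = g v (fun u => Y (val u)).
Proof.
move=> /acyclic_wf wfE.
have nbrP v (u : {u | u \in in_nbr v}) : E (val u) v.
  by have := valP u; rewrite inE.
pose F v (rec : forall u, E u v -> A) := g v (fun u => rec (val u) (nbrP v u)).
exists (Fix wfE (fun=> A) F) => v; rewrite Fix_eq// => w h1 h2 h12.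
by congr g; apply/funext => u; exact: h12.
Qed.

End graph.

Section lipschitz.
Variables (R : realType) (A : finType).
Implicit Types (x y : A -> R) (f : (A -> R) -> R).

Definition norm1 x : R := \sum_(a : A) `|x a|.

Definition dist1 x y : R := norm1 (fun a => x a - y a).

Definition globally_lipschitz f : Prop :=
  exists k : R, forall x y, `|f x - f y| <= k * dist1 x y.

(* Real-valued supremum: it is the mathematical one as soon as [f] is globally
   Lipschitz, with value 0 when [A] is empty. *)
Definition lip_norm f : R :=
  sup [set r : R | exists x y, x <> y /\ r = `|f x - f y| / dist1 x y].

End lipschitz.

Section laws.
Variable R : realType.
Local Open Scope ereal_scope.
Implicit Types mu nu : set R -> \bar R.

(* Laws are handled as set functions, of which only the values on Borel sets
   are relevant; couplings are genuine probability measures. *)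
Definition coupling mu nu (pi : probability (R * R)%type R) : Prop :=
  forall A : set R, measurable A ->
    pi (fst @^-1` A) = mu A /\ pi (snd @^-1` A) = nu A.

Definition wasserstein1 mu nu : \bar R :=
  ereal_inf [set \int[pi]_z `|z.1 - z.2|%:E
            | pi in [set pi : probability (R * R)%type R | coupling mu nu pi]].

Definition mean mu : R := fine (\int[mu]_t t%:E).

Definition lower_cell mu : set R := [set x | (x < mean mu)%R].
Definition upper_cell mu : set R := [set x | (x >= mean mu)%R].

Definition conditional mu (B : set R) : set R -> \bar R :=
  fun A => (fine (mu (A `&` B)) / fine (mu B))%:E.

Definition splits mu : bool := (0 < mu (lower_cell mu)) && (0 < mu (upper_cell mu)).

Fixpoint quantize (n : nat) mu : set R -> \bar R :=
  if n is n'.+1 then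
    if splits mu then
      fun A =>
        mu (upper_cell mu) * quantize n' (conditional mu (upper_cell mu)) A +
        mu (lower_cell mu) * quantize n' (conditional mu (lower_cell mu)) A
    else \d_(mean mu)
  else \d_(mean mu).

Fixpoint final_cells (n : nat) mu : seq (set R) :=
  if n is n'.+1 then
    if splits mu then
      [seq upper_cell mu `&` C
      | C <- final_cells n' (conditional mu (upper_cell mu))] ++
      [seq lower_cell mu `&` C
      | C <- final_cells n' (conditional mu (lower_cell mu))]
    else [:: setT]
  else [:: setT].

Definition msupport mu : set R :=
  [set x | forall U : set R, open U -> U x -> 0 < mu U].

Definition diam (A : set R) : \bar R :=
  ereal_sup [set `|x - y|%:E | x in A & y in A].

Definition atoms mu : set R := [set x | 0 < mu [set x]].

End laws.

Section random_variables.
Context d (T : measurableType d) (R : realType) (P : probability T R).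
Implicit Type X : T -> R.

Definition law X : set R -> \bar R := pushforward P X.

Definition mutually_independent (I : finType) (X : I -> T -> R) : Prop :=
  forall (J : {set I}) (A : I -> set R), (forall i, measurable (A i)) ->
    P (\bigcap_(i in [set` J]) X i @^-1` A i) =
    (\prod_(i in J) P (X i @^-1` A i))%E.

Definition cond_expectation X (B : set R) : R :=
  (\int[P]_(w in X @^-1` B) X w) / fine (P (X @^-1` B)).

Definition quantize_rv (n : nat) X : T -> R := fun w =>
  \sum_(C <- final_cells n (law X)) \1_C (X w) * cond_expectation X C.

Definition compress_rv (n : nat) X : T -> R :=
  if ~~ (atoms (law X) #<= `I_(2 ^ n))%card then quantize_rv n X else X.

End random_variables.

Section networks.
Context d (T : measurableType d) (R : realType) (P : probability T R).
Variables (V : finType) (E : rel V).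
(* [f v] is only relevant at the vertices [v] that are not sources. *)
Variable f : forall v : V, ({u | u \in in_nbr E v} -> R) -> R.

Definition is_dcg (X : {s | s \in sources E} -> T -> R) (Y : V -> T -> R) : Prop :=
  (forall s, Y (val s) = X s) /\
  (forall v, v \notin sources E ->
     Y v = fun w => @f v (fun u : {u | u \in in_nbr E v} => Y (val u) w)).

Definition is_cqdcg (n : nat) (X : {s | s \in sources E} -> T -> R)
    (Y : V -> T -> R) : Prop :=
  (forall s, Y (val s) = quantize_rv P n (X s)) /\
  (forall v, v \notin sources E ->
     Y v = compress_rv P n
             (fun w => @f v (fun u : {u | u \in in_nbr E v} => Y (val u) w))).

Lemma is_dcg_exists (X : {s | s \in sources E} -> T -> R) :
  acyclic E -> exists Y, is_dcg X Y.
Proof.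
move=> acE.
pose g v (y : {u | u \in in_nbr E v} -> T -> R) : T -> R :=
  if insub v is Some s then X s else fun w => @f v (fun u => y u w).
have [Y YE] := acyclic_rec g acE.
exists Y; split=> [s|v vS]; rewrite YE /g; first by rewrite valK.
by rewrite insubN.
Qed.

Lemma is_cqdcg_exists (n : nat) (X : {s | s \in sources E} -> T -> R) :
  acyclic E -> exists Y, is_cqdcg n X Y.
Proof.
move=> acE.
pose g v (y : {u | u \in in_nbr E v} -> T -> R) : T -> R :=
  if insub v is Some s then quantize_rv P n (X s)
  else compress_rv P n (fun w => @f v (fun u => y u w)).
have [Y YE] := acyclic_rec g acE.
exists Y; split=> [s|v vS]; rewrite YE /g; first by rewrite valK.
by rewrite insubN.
Qed.

End networks.

(* Main.v *)
(** Couple the two networks on the space carrying [X]. At a vertex [v] that is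
    not a source the error [E |Y v - Yc v|] is at most [lip_norm (f v)] times
    the sum of the errors at the in-neighbours, plus the error of compressing
    the value [Z] at [v]; unrolling this recursion gives the sum over paths.

    At a source the coupling [(X, Q_n X)] is optimal, because an explicit
    1-Lipschitz Kantorovich potential [phi] satisfies
    [phi x - phi (Q x) = |x - Q x|].

    For a law with mean [m] on [[a, b]] the quantization error is at most
    [2^-n * sqrt ((m - a) * (b - m))], since splitting at the mean at least
    halves the average of this square root over the two parts; this leaves room
    below the constant 3 of the theorem. The oscillation of [Z] is in turn controlled by the oscillations
    at the in-neighbours, and quantization does not increase it. *)

Require Import Defs.
From HB Require Import structures.
From mathcomp Require Import all_boot all_order all_algebra.
From mathcomp Require Import all_classical all_reals all_analysis.
From mathcomp Require Import measurable_realfun.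
From mathcomp Require Import ring lra.

Set Implicit Arguments.
Unset Strict Implicit.
Unset Printing Implicit Defensive.

Import Order.TTheory GRing.Theory Num.Theory.
Import numFieldNormedType.Exports.

Local Open Scope classical_set_scope.
Local Open Scope ring_scope.

(** * Integration against set functions and image measures *)

Lemma probability_inhabited d (T : measurableType d) (R : realType)
    (P : probability T R) : [set: T] !=set0.
Proof.
apply/set0P/eqP => T0; have := probability_setT P.
by rewrite T0 measure0 => /(congr1 fine)/= /esym/eqP; rewrite oner_eq0.
Qed.

Section set_function.
Import HBNNSimple.

(** The integral is a difference of suprema of integrals of simple functions, and these evaluate the
    set function on measurable level sets only. A law given as a bare set function can thus be
    traded for a measure. *)
Lemma eq_set_function_integral d (T : measurableType d) (R : realType)
    (m1 m2 : set T -> \bar R) (D : set T) (f : T -> \bar R) :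
  (forall A, measurable A -> m1 A = m2 A) ->
  (\int[m1]_(x in D) f x = \int[m2]_(x in D) f x)%E.
Proof.
move=> m12; have sE (h : {nnsfun T >-> R}) : sintegral m1 h = sintegral m2 h.
  by apply: eq_fsbigr => r _; rewrite m12.
by rewrite /integral; congr (ereal_sup _ - ereal_sup _)%E;
  apply/seteqP; split => _ [h hf <-]; exists h.
Qed.

End set_function.

Lemma ge0_integral_mrestr d (T : measurableType d) (R : realType)
    (mu : {measure set T -> \bar R}) (C : set T) (mC : measurable C)
    (f : T -> \bar R) : measurable_fun setT f -> (forall x, 0 <= f x)%E ->
  (\int[mrestr mu mC]_x f x = \int[mu]_(x in C) f x)%E.
Proof.
move=> mf f0.
have mN0 : mrestr mu mC (~` C) = 0%E by rewrite /mrestr setICl measure0.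
rewrite [LHS](ge0_negligible_integral (measurableC mC) measurableT)//.
rewrite setTD setCK; apply: eq_measure_integral => A mA AC.
by rewrite /= /mrestr setIidl.
Qed.

Lemma integral_mrestr d (T : measurableType d) (R : realType)
    (mu : {measure set T -> \bar R}) (C : set T) (mC : measurable C)
    (f : T -> \bar R) : measurable_fun setT f ->
  (\int[mrestr mu mC]_x f x = \int[mu]_(x in C) f x)%E.
Proof.
move=> mf; rewrite [LHS]integralE [RHS]integralE !ge0_integral_mrestr//;
  [exact: measurable_funeneg|exact: measurable_funepos].
Qed.

Lemma integral_mscale d (T : measurableType d) (R : realType)
    (mu : {measure set T -> \bar R}) (k : {nonneg R}) (f : T -> \bar R) :
  mu.-integrable setT f ->
  (\int[mscale k mu]_x f x = k%:num%:E * \int[mu]_x f x)%E.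
Proof.
move=> fi; have mf := measurable_int _ fi.
rewrite [LHS]integralE [in RHS]integralE !ge0_integral_mscale//;
  [|exact: measurable_funeneg|exact: measurable_funepos].
by rewrite [RHS]muleBr//; exact: integrable_add_def.
Qed.

Section image_measure.
Context d d' (T : measurableType d) (T' : measurableType d') (R : realType).
Context (P : {measure set T -> \bar R}) (X : T -> T') (nu : set T' -> \bar R).
Hypotheses (mX : measurable_fun setT X)
  (nuE : forall A, measurable A -> nu A = P (X @^-1` A)).

Let mX' := isMeasurableFun.Build _ _ _ _ _ mX.
Let X' : {mfun T >-> T'} := HB.pack X mX'.

(** [nu] agrees with the image of [P] on measurable sets only, so that a law given as a bare set
    function qualifies. *)
Lemma ge0_integral_image (f : T' -> \bar R) :
  measurable_fun setT f -> (forall y, 0 <= f y)%E ->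
  (\int[nu]_y f y = \int[P]_x f (X x))%E.
Proof.
move=> mf f0; rewrite (eq_set_function_integral (m2 := pushforward P X))//.
by rewrite ge0_integral_pushforward.
Qed.

Lemma integral_image (f : T' -> \bar R) : measurable_fun setT f ->
  (\int[nu]_y f y = \int[P]_x f (X x))%E.
Proof.
move=> mf; rewrite (eq_set_function_integral (m2 := pushforward P X'))//.
have tE (g : T' -> \bar R) : measurable_fun setT g -> (forall y, 0 <= g y)%E ->
    (\int[pushforward P X']_y g y = \int[P]_x g (X x))%E.
  by move=> mg g0; rewrite ge0_integral_pushforward.
rewrite [LHS]integralE [RHS]integralE.
rewrite (tE _ (measurable_funepos mf))// (tE _ (measurable_funeneg mf))//.
by congr (_ - _)%E; apply: eq_integral => x _; rewrite !unlock.
Qed.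

Lemma integrable_image (f : T' -> \bar R) : measurable_fun setT f ->
  nu.-integrable setT f -> P.-integrable setT (fun x => f (X x)).
Proof.
move=> mf /integrableP[_ fin]; apply/integrableP; split.
  exact: measurableT_comp.
by rewrite -(ge0_integral_image (f := fun y => `|f y|%E))//; exact: measurableT_comp.
Qed.

Lemma image_integrable (f : T' -> \bar R) : measurable_fun setT f ->
  P.-integrable setT (fun x => f (X x)) -> nu.-integrable setT f.
Proof.
move=> mf /integrableP[_ fin]; apply/integrableP; split => //.
by rewrite ge0_integral_image//; exact: measurableT_comp.
Qed.

End image_measure.

(** * Quantization as a map of the real line *)

Section quantizer.
Context {R : realType} (mu : probability R R).
Implicit Types (A B C : set R) (x y : R) (m : set R -> \bar R).

Definition mass C : R := fine (mu C).

Definition centre C : R := (\int[mu]_(x in C) x) / mass C.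

Definition below C : set R := C `&` [set x | x < centre C].

Definition above C : set R := C `&` [set x | centre C <= x].

Definition divisible C : bool := (0 < mass (below C)) && (0 < mass (above C)).

(** The quantizer as a deterministic map. The recursion shrinks the cell [C] and keeps the measure
    [mu] fixed; points outside [C] receive a value too, so that the map is total. *)
Fixpoint qmap (n : nat) C x : R :=
  if n is n'.+1 then
    if divisible C then
      if x < centre C then qmap n' (below C) x else qmap n' (above C) x
    else centre C
  else centre C.

(** The invariant that links the recursion on conditioned set functions in [quantize] and
    [final_cells] to the recursion on cells in [qmap]. *)
Definition is_conditional C m : Prop :=
  forall A, measurable A -> m A = (mass (A `&` C) / mass C)%:E.

Lemma massE C : measurable C -> mu C = (mass C)%:E.
Proof. by move=> mC; rewrite fineK// fin_num_measure. Qed.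

Lemma mass_ge0 C : 0 <= mass C.
Proof. exact: fine_ge0. Qed.

Lemma mass_setT : mass setT = 1.
Proof. by rewrite /mass probability_setT. Qed.

Lemma massU A B : measurable A -> measurable B -> A `&` B = set0 ->
  mass (A `|` B) = mass A + mass B.
Proof.
by move=> mA mB AB0; rewrite /mass measureU// fineD// fin_num_measure.
Qed.

Lemma le_mass A B : measurable A -> measurable B -> A `<=` B ->
  mass A <= mass B.
Proof.
by move=> mA mB AB; rewrite -lee_fin -!massE// le_measure// inE.
Qed.

Lemma measurable_below_set x : measurable [set y : R | y < x].
Proof. by rewrite -set_itvNyo; exact: measurable_itv. Qed.

Lemma measurable_above_set x : measurable [set y : R | x <= y].
Proof. by rewrite -set_itvcy; exact: measurable_itv. Qed.

Lemma measurable_below C : measurable C -> measurable (below C).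
Proof. by move=> mC; apply: measurableI => //; exact: measurable_below_set. Qed.

Lemma measurable_above C : measurable C -> measurable (above C).
Proof. by move=> mC; apply: measurableI => //; exact: measurable_above_set. Qed.

Lemma below_above0 C : below C `&` above C = set0.
Proof.
rewrite -subset0 => x [[_ /= xlt] [_ /=]].
by rewrite leNgt xlt.
Qed.

Lemma below_aboveE C : C = below C `|` above C.
Proof.
apply/seteqP; split=> [x Cx|x [[]//|[]//]].
by have [xlt|xge] := ltP x (centre C); [left|right].
Qed.

Lemma mass_split C : measurable C -> mass C = mass (below C) + mass (above C).
Proof.
move=> mC; rewrite [in LHS](below_aboveE C) massU ?below_above0//;
  [exact: measurable_below|exact: measurable_above].
Qed.

Lemma measurable_qmap n C : measurable_fun setT (qmap n C).
Proof.
elim: n C => [|n IHn] C /=; first exact: measurable_cst.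
case: divisible; last exact: measurable_cst.
by apply: measurable_fun_ifT => //; apply: measurable_fun_ltr.
Qed.

Section conditional_law.
Hypothesis imu : mu.-integrable setT (fun x : R => x%:E).

(** On Borel sets [m] is the restriction of [mu] to [C], scaled by the inverse of the mass of [C];
    integrals scale accordingly. *)
Lemma is_conditional_mean C m : measurable C -> 0 < mass C ->
  is_conditional C m -> mean m = centre C.
Proof.
move=> mC C0 mE.
have k0 : 0 <= (mass C)^-1 by rewrite invr_ge0 ltW.
pose k := NngNum k0.
have iC : (mrestr mu mC).-integrable setT (fun x : R => x%:E).
  have [mid fid] := integrableP _ _ _ imu.
  apply/integrableP; split => //.
  rewrite ge0_integral_mrestr//; last exact: measurableT_comp.
  apply: le_lt_trans fid; apply: ge0_subset_integral => //.
  exact: measurableT_comp.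
rewrite /mean (eq_set_function_integral (m2 := mscale k (mrestr mu mC))); last first.
  move=> A mA; rewrite mE// /mscale/= /mrestr massE; last exact: measurableI.
  by rewrite -EFinM mulrC.
rewrite integral_mscale// integral_mrestr; last exact: (measurable_int _ iC).
rewrite fineM//; last first.
  apply: integrable_fin_num => //; apply: integrableS imu => //.
by rewrite mulrC.
Qed.

Lemma is_conditional_setT m :
  (forall A, measurable A -> m A = mu A) -> is_conditional setT m.
Proof.
by move=> mE A mA; rewrite mE// setIT mass_setT divr1 massE.
Qed.

(** Conditioning twice is conditioning once on the intersection: the mass of [C] cancels in the
    quotient. *)
Lemma is_conditional_conditional C m B : measurable C -> measurable B ->
  0 < mass (C `&` B) -> is_conditional C m ->
  is_conditional (C `&` B) (conditional m B).
Proof.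
move=> mC mB CB0 mE A mA.
have C0 : 0 < mass C.
  apply: lt_le_trans CB0 _; apply: le_mass => //; first exact: measurableI.
rewrite /conditional !mE//; last exact: measurableI.
rewrite -setIA [B `&` C]setIC; congr EFin; rewrite /=.
by field; rewrite !gt_eqF.
Qed.

Lemma is_conditional_splits C m : measurable C -> 0 < mass C ->
  is_conditional C m -> splits m = divisible C.
Proof.
move=> mC C0 mE; rewrite /splits /lower_cell /upper_cell.
rewrite (is_conditional_mean mC C0 mE).
rewrite !mE; [|exact: measurable_above_set|exact: measurable_below_set].
by rewrite !lte_fin !pmulr_lgt0 ?invr_gt0// !(setIC _ C).
Qed.

Lemma sum_final_cells n C m x : measurable C -> 0 < mass C ->
  is_conditional C m ->
  \sum_(B <- final_cells n m) \1_B x * centre (C `&` B) = qmap n C x.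
Proof.
elim: n C m => [|n IHn] C m mC C0 mE /=.
  by rewrite big_seq1 indicT mul1r setIT.
rewrite (is_conditional_splits mC C0 mE); case: ifPn => [/andP[b0 a0]|_]; last first.
  by rewrite big_seq1 indicT mul1r setIT.
have cE := is_conditional_mean mC C0 mE.
rewrite big_cat /= !big_map.
(* The cells of a half are intersected with that half, so their indicators share the factor
   [\1_B x]. It vanishes for one of the two halves, and the other sum is the induction
   hypothesis. *)
have sE B m' : \sum_(D <- final_cells n m') \1_(B `&` D) x * centre (C `&` (B `&` D))
    = \1_B x * \sum_(D <- final_cells n m') \1_D x * centre (C `&` B `&` D).
  rewrite big_distrr /=; apply: eq_bigr => D _.
  by rewrite indicI /= mulrA setIA.
rewrite !sE /upper_cell /lower_cell cE !IHn//.
- rewrite !indicE /=; have [xlt|xge] := ltP x (centre C).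
    by rewrite memNset ?mul0r ?add0r ?mem_set ?mul1r//= leNgt xlt.
  by rewrite addrC memNset ?mul0r ?add0r ?mem_set ?mul1r//= ltNge xge.
- exact: measurable_below.
- exact: is_conditional_conditional (measurable_below_set _) b0 mE.
- exact: measurable_above.
- exact: is_conditional_conditional (measurable_above_set _) a0 mE.
Qed.

(** Identifies [quantize n m] as the law of [qmap n C] under [mu] conditioned on [C]. In the
    induction the relative mass of a half cancels the normalization of the conditional law on it. *)
Lemma quantizeE n C m A : measurable C -> 0 < mass C ->
  is_conditional C m -> measurable A ->
  quantize n m A = (mass (C `&` qmap n C @^-1` A) / mass C)%:E.
Proof.
move=> mC C0 mE mA.
have diracE D c : 0 < mass D ->
    \d_c A = (mass (D `&` cst c @^-1` A) / mass D)%:E.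
  move=> D0; rewrite diracE; case: (boolP (c \in A)) => cA.
    rewrite (_ : _ @^-1` A = setT) ?setIT ?divff ?gt_eqF//.
    by apply/seteqP; split=> // y _ /=; exact: set_mem.
  rewrite (_ : _ @^-1` A = set0) ?setI0 /mass ?measure0 ?mul0r//.
  by apply/seteqP; split=> // y /= /mem_set; rewrite (negbTE cA).
elim: n C m mC C0 mE => [|n IHn] C m mC C0 mE /=.
  by rewrite (is_conditional_mean mC C0 mE) (diracE C).
rewrite (is_conditional_splits mC C0 mE); case: ifPn => [dC|_]; last first.
  by rewrite (is_conditional_mean mC C0 mE) (diracE C).
have /andP[b0 a0] := dC.
have mb := measurable_below mC; have ma := measurable_above mC.
rewrite /upper_cell /lower_cell (is_conditional_mean mC C0 mE).
rewrite (IHn (above C))//; last first.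
  exact: is_conditional_conditional (measurable_above_set _) a0 mE.
rewrite (IHn (below C))//; last first.
  exact: is_conditional_conditional (measurable_below_set _) b0 mE.
rewrite !mE; [|exact: measurable_below_set|exact: measurable_above_set].
rewrite !(setIC _ C) -/(above C) -/(below C).
set q := (fun x => _).
have -> : C `&` q @^-1` A = (below C `&` qmap n (below C) @^-1` A) `|`
    (above C `&` qmap n (above C) @^-1` A).
  rewrite {1}(below_aboveE C) setIUl; congr (_ `|` _); apply/seteqP; split.
  - by move=> x [[Cx /= xlt]]; rewrite /q /= xlt; split.
  - by move=> x [[Cx /= xlt] Ax]; rewrite /q /= xlt; split.
  - by move=> x [[Cx /= xge]]; rewrite /q /= ltNge xge; split.
  - by move=> x [[Cx /= xge] Ax]; rewrite /q /= ltNge xge; split.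
have mqA D : measurable D -> measurable (D `&` qmap n D @^-1` A).
  move=> mD; apply: measurableI => //; rewrite -[_ @^-1` _]setTI.
  exact: measurable_qmap.
rewrite massU; [|exact: mqA|exact: mqA|]; last first.
  by rewrite setIACA below_above0 set0I.
by rewrite -!EFinM -EFinD; congr EFin; field; rewrite !gt_eqF.
Qed.

End conditional_law.
End quantizer.

(** * Optimality and size of the quantization error *)

(** The point [c] cuts the segment between [x] and [y] into a part below and a part above, whose
    lengths are the two terms on the left. *)
Lemma clamp_dist (R : realDomainType) (x y c : R) :
  `|Num.min x c - Num.min y c| + `|Num.max x c - Num.max y c| <= `|x - y|.
Proof.
wlog xy : x y / x <= y.
  move=> wl; have /orP[xy|yx] := le_total x y; first exact: wl.
  by rewrite distrC [X in _ + X]distrC [leRHS]distrC; exact: wl.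
rewrite (distrC x) [leRHS]ger0_norm ?subr_ge0//.
by case: (lerP x c) => xc; case: (lerP y c) => yc;
  rewrite ?subrr ?normr0 ?addr0 ?add0r; do ?[rewrite ler0_norm; last by lra]; lra.
Qed.

(** By the balance at [m] both terms on the left equal [g = p * (m - c1)]. Since [g <= p * (m - a)]
    and [g <= q * (b - m)], the bound follows from [4 * p * q <= (p + q) ^+ 2]. The bounds on [c1]
    and [c2] are conditional because a half may be null. *)
Lemma base_contraction (R : rcfType) (a b p q m c1 c2 : R) :
  0 <= p -> 0 <= q -> (p + q) * m = p * c1 + q * c2 ->
  a <= m <= b -> (0 < p -> a <= c1) -> (0 < q -> c2 <= b) ->
  p * (m - c1) + q * (c2 - m) <= (p + q) * Num.sqrt ((m - a) * (b - m)).
Proof.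
move=> p0 q0 mE /andP[am mb] ac1 c2b.
have gE : q * (c2 - m) = p * (m - c1) by lra.
rewrite gE; set g := p * (m - c1) in gE *.
have s0 : 0 <= (p + q) * Num.sqrt ((m - a) * (b - m)).
  by rewrite mulr_ge0// ?addr_ge0// sqrtr_ge0.
have [g0|g0] := leP g 0; first by apply: le_trans s0; lra.
have g1 : g <= p * (m - a).
  have [p0'|] := ltP 0 p; first by rewrite ler_wpM2l// lerD2l lerN2 ac1.
  move=> p0'; have p00 : p = 0 by lra.
  by rewrite /g p00 !mul0r.
have g2 : g <= q * (b - m).
  rewrite -gE.
  have [q0'|] := ltP 0 q; first by rewrite ler_wpM2l// lerD2r c2b.
  move=> q0'; have q00 : q = 0 by lra.
  by rewrite q00 !mul0r.
rewrite -ler_sqr ?nnegrE//; last by lra.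
rewrite [leRHS]exprMn sqr_sqrtr; last by rewrite mulr_ge0// subr_ge0.
have h1 : g ^+ 2 <= (p * (m - a)) * (q * (b - m)).
  by rewrite expr2 ler_pM// ltW.
have h2 : 0 <= (p - q) ^+ 2 * ((m - a) * (b - m)).
  by apply: mulr_ge0; [exact: sqr_ge0|apply: mulr_ge0; rewrite subr_ge0].
by nra.
Qed.

(* With g = p (m - c1) = q (c2 - m), A = p (c1 - a) and B = q (b - c2), the left
   side is sqrt (A g) + sqrt (g B) <= sqrt ((A + g) (g + B)) by Cauchy-Schwarz,
   and (A + g) (g + B) = p q (m - a) (b - m) with 4 p q <= (p + q)^2. *)
Lemma step_contraction (R : rcfType) (a b p q m c1 c2 : R) :
  0 <= p -> 0 <= q -> (p + q) * m = p * c1 + q * c2 ->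
  a <= c1 -> c1 <= m -> m <= c2 -> c2 <= b ->
  p * Num.sqrt ((c1 - a) * (m - c1)) + q * Num.sqrt ((c2 - m) * (b - c2)) <=
  2^-1 * ((p + q) * Num.sqrt ((m - a) * (b - m))).
Proof.
move=> p0 q0 mE ac1 c1m mc2 c2b.
have gE : q * (c2 - m) = p * (m - c1) by lra.
set s := Num.sqrt ((c1 - a) * _); set t := Num.sqrt ((c2 - m) * _).
set g := p * (m - c1) in gE *.
pose A := p * (c1 - a); pose B := q * (b - c2).
have s0 : 0 <= s by exact: sqrtr_ge0.
have t0 : 0 <= t by exact: sqrtr_ge0.
have g0 : 0 <= g by rewrite mulr_ge0// subr_ge0.
have A0 : 0 <= A by rewrite mulr_ge0// subr_ge0.
have B0 : 0 <= B by rewrite mulr_ge0// subr_ge0.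
have sE : (p * s) ^+ 2 = A * g.
  rewrite exprMn sqr_sqrtr; last by rewrite mulr_ge0// subr_ge0.
  by rewrite /A /g; ring.
have tE : (q * t) ^+ 2 = g * B.
  rewrite exprMn sqr_sqrtr; last by rewrite mulr_ge0// subr_ge0.
  by rewrite -gE /B; ring.
have ps0 : 0 <= p * s by rewrite mulr_ge0.
have qt0 : 0 <= q * t by rewrite mulr_ge0.
have psqt : 2 * ((p * s) * (q * t)) <= A * B + g ^+ 2.
  rewrite -ler_sqr ?nnegrE; last 2 first.
  - by apply: mulr_ge0 => //; exact: mulr_ge0.
  - by apply: addr_ge0; [exact: mulr_ge0|exact: sqr_ge0].
  have -> : (2 * ((p * s) * (q * t))) ^+ 2 = 4 * ((p * s) ^+ 2 * (q * t) ^+ 2).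
    by ring.
  rewrite sE tE -subr_ge0.
  have -> : (A * B + g ^+ 2) ^+ 2 - 4 * (A * g * (g * B)) = (A * B - g ^+ 2) ^+ 2.
    by ring.
  exact: sqr_ge0.
rewrite -ler_sqr ?nnegrE; last 2 first.
- by rewrite addr_ge0.
- by rewrite mulr_ge0 ?invr_ge0// mulr_ge0 ?addr_ge0 ?sqrtr_ge0.
have am : a <= m by exact: le_trans c1m.
have mb : m <= b by exact: le_trans c2b.
rewrite !exprMn sqr_sqrtr; last by rewrite mulr_ge0// subr_ge0.
have -> : (p * s + q * t) ^+ 2 =
    (p * s) ^+ 2 + (q * t) ^+ 2 + 2 * ((p * s) * (q * t)) by ring.
rewrite sE tE.
have AgE : A + g = p * (m - a) by rewrite /A /g; ring.
have BgE : B + g = q * (b - m) by rewrite -gE /B; ring.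
apply: (@le_trans _ _ ((A + g) * (B + g))); first by lra.
rewrite AgE BgE.
have h2 : 0 <= (p - q) ^+ 2 * ((m - a) * (b - m)).
  by apply: mulr_ge0; [exact: sqr_ge0|apply: mulr_ge0; rewrite subr_ge0].
by rewrite exprVn; lra.
Qed.

Section quantization_error.
Context {R : realType} (mu : probability R R).
Hypothesis imu : mu.-integrable setT (fun x : R => x%:E).
Implicit Types (A B C : set R) (x y : R).

Let imuS C : measurable C -> mu.-integrable C (EFin \o id).
Proof. by move=> mC; apply: integrableS imu. Qed.

Let icst C (r : R) : measurable C -> mu.-integrable C (EFin \o cst r).
Proof.
by move=> mC; exact: finite_measure_integrable_cst.
Qed.

Lemma integral_id C : measurable C ->
  \int[mu]_(x in C) x = mass mu C * centre mu C.
Proof.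
move=> mC; rewrite /centre.
have [C0|C0] := eqVneq (mass mu C) 0; last by rewrite mulrC divfK.
rewrite C0 mul0r /Rintegral null_set_integral//.
by apply: (etrans (massE mu mC)); rewrite C0.
Qed.

Lemma mass_centre_split C : measurable C ->
  mass mu C * centre mu C =
  mass mu (below mu C) * centre mu (below mu C) +
  mass mu (above mu C) * centre mu (above mu C).
Proof.
move=> mC; have mb := measurable_below mu mC; have ma := measurable_above mu mC.
rewrite -!integral_id// [in LHS](below_aboveE mu C) Rintegral_setU//.
  by rewrite -below_aboveE; exact: imuS.
by apply/disj_setPS; rewrite below_above0.
Qed.

Lemma centre_le C (b : R) : measurable C -> 0 < mass mu C ->
  (forall x, C x -> x <= b) -> centre mu C <= b.
Proof.
move=> mC C0 Cb; rewrite -(ler_pM2l C0) -integral_id// mulrC -Rintegral_cst//.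
by apply: le_Rintegral => //; [exact: imuS|exact: icst].
Qed.

Lemma le_centre C (a : R) : measurable C -> 0 < mass mu C ->
  (forall x, C x -> a <= x) -> a <= centre mu C.
Proof.
move=> mC C0 Ca; rewrite -(ler_pM2l C0) -integral_id// mulrC -Rintegral_cst//.
by apply: le_Rintegral => //; [exact: icst|exact: imuS].
Qed.

(** Turns bounds on centres of cells of positive mass into bounds on values of [qmap], and shows
    that each value is charged by the image of [mu]. The point [x] need not lie in [B]. *)
Lemma qmap_cell n C x : measurable C -> 0 < mass mu C ->
  exists B, [/\ measurable B, B `<=` C, 0 < mass mu B,
    centre mu B = qmap mu n C x &
    forall y, B y -> qmap mu n C y = qmap mu n C x].
Proof.
elim: n C => [|n IHn] C mC C0 /=; first by exists C; split.
case: ifPn => [/andP[b0 a0]|_]; last by exists C; split.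
have [xlt|xge] := ltP x (centre mu C).
  have [B [mB BC B0 cB qB]] := IHn _ (measurable_below mu mC) b0.
  exists B; split=> //; first by move=> y /BC[].
  by move=> y By; have [_ /= ->] := BC _ By; exact: qB.
have [B [mB BC B0 cB qB]] := IHn _ (measurable_above mu mC) a0.
exists B; split=> //; first by move=> y /BC[].
by move=> y By; have [_ /=] := BC _ By; rewrite leNgt => /negbTE ->; exact: qB.
Qed.

Lemma qmap_bounded n C : exists M : R, forall x, `|qmap mu n C x| <= M.
Proof.
elim: n C => [|n IHn] C /=; first by exists `|centre mu C|.
case: (divisible mu C); last by exists `|centre mu C|.
have [M1 h1] := IHn (below mu C); have [M2 h2] := IHn (above mu C).
exists (Num.max M1 M2) => x.
by case: ifP => _; rewrite le_max ?h1 ?h2 ?orbT.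
Qed.

Lemma qmap_below_le n C x : measurable C -> 0 < mass mu (below mu C) ->
  qmap mu n (below mu C) x <= centre mu C.
Proof.
move=> mC b0.
have [B [mB BC B0 <- _]] := qmap_cell n x (measurable_below mu mC) b0.
by apply: centre_le => // y /BC[_ /ltW].
Qed.

Lemma qmap_above_ge n C x : measurable C -> 0 < mass mu (above mu C) ->
  centre mu C <= qmap mu n (above mu C) x.
Proof.
move=> mC a0.
have [B [mB BC B0 <- _]] := qmap_cell n x (measurable_above mu mC) a0.
by apply: le_centre => // y /BC[].
Qed.

(* A Kantorovich potential certifying that the map [qmap] is an optimal
   transport; at each split the potentials of the two halves are glued
   continuously. *)
Fixpoint potential (n : nat) C x : R :=
  if n is n'.+1 then
    if divisible mu C then
      potential n' (below mu C) (Num.min x (centre mu C)) +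
      potential n' (above mu C) (Num.max x (centre mu C))
    else `|x - centre mu C|
  else `|x - centre mu C|.

(** The potentials of the two halves see the points clamped at the centre from above and from below,
    and [clamp_dist] adds up the two displacements. *)
Lemma potential_lip n C x y :
  `|potential n C x - potential n C y| <= `|x - y|.
Proof.
have base (u v c : R) : `| `|u - c| - `|v - c| | <= `|u - v|.
  by apply: le_trans (ler_dist_dist _ _) _; rewrite opprB addrA subrK.
elim: n C x y => [|n IHn] C x y /=; first exact: base.
case: (divisible mu C); last exact: base.
apply: le_trans (clamp_dist x y (centre mu C)).
by rewrite opprD addrACA; apply: le_trans (ler_normD _ _) _; exact: lerD.
Qed.

(** A point and its image lie on the same side of the centre. Clamping fixes both on that side and
    sends both to the centre on the other, where the contributions cancel. *)
Lemma potential_qmap n C x : measurable C -> 0 < mass mu C ->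
  potential n C x - potential n C (qmap mu n C x) = `|x - qmap mu n C x|.
Proof.
elim: n C => [|n IHn] C mC C0 /=; first by rewrite subrr normr0 subr0.
case: ifPn => [/andP[b0 a0]|_]; last by rewrite subrr normr0 subr0.
have [xlt|xge] := ltP x (centre mu C).
  have qc := qmap_below_le n x mC b0.
  rewrite !min_l ?(ltW xlt)// !max_r ?(ltW xlt)//.
  by rewrite opprD addrACA subrr addr0 IHn//; exact: measurable_below.
have qc := qmap_above_ge n x mC a0.
rewrite !min_r// !max_l//.
by rewrite opprD addrACA subrr add0r IHn//; exact: measurable_above.
Qed.

Lemma measurable_potential n C : measurable_fun setT (potential n C).
Proof.
have base c : measurable_fun setT (fun x : R => `|x - c|).
  by apply: measurableT_comp => //; exact: measurable_funB.
elim: n C => [|n IHn] C /=; first exact: base.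
case: divisible; last exact: base.
by apply: measurable_funD; apply: measurableT_comp => //;
  [exact: measurable_minr|exact: measurable_maxr].
Qed.

Lemma measurable_dist_qmap n C :
  measurable_fun setT (fun x => `|x - qmap mu n C x|).
Proof.
by apply: measurableT_comp => //; apply: measurable_funB => //;
  exact: measurable_qmap.
Qed.

Lemma integrable_dist_qmap n C :
  mu.-integrable setT (fun x => `|x - qmap mu n C x|%:E).
Proof.
have [M qM] := qmap_bounded n C.
apply: (@le_integrable _ _ _ _ _ measurableT _
    (fun x => (`|x|%:E + (cst M%:E) x)%E)).
- by apply/measurable_EFinP; exact: measurable_dist_qmap.
- move=> x _; rewrite -EFinD lee_fin normr_id.
  apply: le_trans (ler_norm _); apply: le_trans (ler_normB _ _) _.
  by rewrite lerD2l.
- apply: integrableD => //; first exact: (integrable_norm imu).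
  by apply: finite_measure_integrable_cst.
Qed.

Lemma Rintegral_below_above C (g : R -> R) : measurable C ->
  mu.-integrable C (EFin \o g) ->
  \int[mu]_(x in C) g x =
  \int[mu]_(x in below mu C) g x + \int[mu]_(x in above mu C) g x.
Proof.
move=> mC ig; have mb := measurable_below mu mC; have ma := measurable_above mu mC.
rewrite [in LHS](below_aboveE mu C) Rintegral_setU//.
  by rewrite -below_aboveE.
by apply/disj_setPS; rewrite below_above0.
Qed.

Lemma integral_dist_centre C : measurable C ->
  \int[mu]_(x in C) `|x - centre mu C| =
  mass mu (below mu C) * (centre mu C - centre mu (below mu C)) +
  mass mu (above mu C) * (centre mu (above mu C) - centre mu C).
Proof.
move=> mC; have mb := measurable_below mu mC; have ma := measurable_above mu mC.
rewrite Rintegral_below_above//; last first.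
  exact: integrableS (integrable_dist_qmap 0 C).
congr (_ + _).
  rewrite (@eq_Rintegral _ _ _ _ _ (fun x => centre mu C - x)); last first.
    by move=> x /set_mem[_ /= xlt]; rewrite distrC ger0_norm// subr_ge0 ltW.
  rewrite RintegralB//; [|exact: icst|exact: imuS].
  by rewrite integral_id// Rintegral_cst//= mulrBr mulrC.
rewrite (@eq_Rintegral _ _ _ _ _ (fun x => x - centre mu C)); last first.
  by move=> x /set_mem[_ /= xge]; rewrite ger0_norm// subr_ge0.
rewrite RintegralB//; [|exact: imuS|exact: icst].
by rewrite integral_id// Rintegral_cst//= mulrBr [in X in _ - X]mulrC.
Qed.

(** Induction on [n], each split gaining the factor 1/2 of [step_contraction]. The interval bounds
    centres of subsets rather than points, because [C] is the whole line in the application. *)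
Lemma integral_dist_qmap n C (a b : R) : measurable C -> 0 < mass mu C ->
  (forall B, measurable B -> B `<=` C -> 0 < mass mu B ->
     a <= centre mu B <= b) ->
  \int[mu]_(x in C) `|x - qmap mu n C x| <=
  (2 ^+ n)^-1 *
  (mass mu C * Num.sqrt ((centre mu C - a) * (b - centre mu C))).
Proof.
have rhs_ge0 k D a' b' : 0 <= (2 ^+ k)^-1 *
    (mass mu D * Num.sqrt ((centre mu D - a') * (b' - centre mu D))).
  by rewrite mulr_ge0 ?invr_ge0 ?exprn_ge0// mulr_ge0 ?mass_ge0 ?sqrtr_ge0.
elim: n C a b => [|n IHn] C a b mC C0 abC /=;
  have mb := measurable_below mu mC; have ma := measurable_above mu mC;
  have bC : below mu C `<=` C by [move=> x []];
  have aC : above mu C `<=` C by [move=> x []].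
  rewrite integral_dist_centre// expr0 invr1 mul1r (mass_split mu mC).
  apply: base_contraction; rewrite ?mass_ge0//.
  - by rewrite -mass_split// mass_centre_split.
  - exact: abC.
  - by move=> /(abC _ mb bC)/andP[].
  - by move=> /(abC _ ma aC)/andP[].
case: (boolP (divisible mu C)) => [dC|ndC] /=; last first.
  rewrite integral_dist_centre//.
  (* The centre balances the two halves, so the two terms agree; one half is null, hence both
     vanish. *)
  have gE : mass mu (below mu C) * (centre mu C - centre mu (below mu C)) =
      mass mu (above mu C) * (centre mu (above mu C) - centre mu C).
    by have := mass_centre_split mC; rewrite (mass_split mu mC); lra.
  have : mass mu (below mu C) = 0 \/ mass mu (above mu C) = 0.
    move: ndC; rewrite negb_and -!leNgt => /orP[] h; [left|right];
    by apply/eqP; rewrite eq_le h mass_ge0.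
  by case=> h0; [rewrite -gE|rewrite gE]; rewrite h0 !mul0r addr0.
have /andP[b0 a0] := dC.
rewrite Rintegral_below_above//; last first.
  by have := integrableS measurableT mC (@subsetT _ _)
    (integrable_dist_qmap n.+1 C); rewrite /= dC.
rewrite (@eq_Rintegral _ _ _ _ (below mu C)
    (fun x => `|x - qmap mu n (below mu C) x|)); last first.
  by move=> x /set_mem[_ /= xlt]; rewrite xlt.
rewrite (@eq_Rintegral _ _ _ _ (above mu C)
    (fun x => `|x - qmap mu n (above mu C) x|)); last first.
  by move=> x /set_mem[_ /= xge]; rewrite ltNge xge.
have bm : centre mu (below mu C) <= centre mu C.
  by apply: centre_le => // x [_ /ltW].
have am : centre mu C <= centre mu (above mu C).
  by apply: le_centre => // x [].
(* The centre of [C] becomes the upper bound for the lower half and the lower bound for the upper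
   half. *)
have hb := IHn _ a (centre mu C) mb b0.
have ha := IHn _ (centre mu C) b ma a0.
have /andP[ab _] := abC _ mb bC b0; have /andP[_ ba] := abC _ ma aC a0.
apply: le_trans (lerD (hb _) (ha _)) _.
- move=> B mB BC B0; have /andP[-> _] := abC _ mB (subset_trans BC bC) B0.
  by apply: centre_le => // x /BC[_ /ltW].
- move=> B mB BC B0; have /andP[_ ->] := abC _ mB (subset_trans BC aC) B0.
  by rewrite andbT; apply: le_centre => // x /BC[].
rewrite -mulrDr exprSr invfM -mulrA ler_wpM2l ?invr_ge0 ?exprn_ge0//.
rewrite (mass_split mu mC); apply: step_contraction; rewrite ?mass_ge0//.
by rewrite -mass_split// mass_centre_split.
Qed.

Lemma integrable_potential n C :
  mu.-integrable setT (fun x => (potential n C x)%:E).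
Proof.
apply: (@le_integrable _ _ _ _ _ measurableT _
    (fun x => (`|x|%:E + (cst `|potential n C 0|%:E) x)%E)).
- by apply/measurable_EFinP; exact: measurable_potential.
- move=> x _; rewrite -EFinD lee_fin; apply: le_trans (ler_norm _).
  rewrite -lerBlDr; apply: le_trans (lerB_dist _ _) _.
  by apply: le_trans (potential_lip _ _ _ _) _; rewrite subr0.
- apply: integrableD => //; first exact: (integrable_norm imu).
  by apply: finite_measure_integrable_cst.
Qed.

Lemma measurable_dist12 :
  measurable_fun setT (fun z : R * R => `|z.1 - z.2|%:E).
Proof.
apply/measurable_EFinP; apply: measurableT_comp => //.
by apply: measurable_funB; [exact: measurable_fst|exact: measurable_snd].
Qed.

(** Weak Kantorovich duality: the cost of [q] is the integral of [h x - h (q x)], which depends on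
    the two marginals only. Under [pi] it becomes the integral of [h z.1 - h z.2], at most the cost
    of [pi] because [h] is 1-Lipschitz. *)
Lemma qmap_optimal n (m : set R -> \bar R) (pi : probability (R * R)%type R) :
  (forall A, measurable A -> m A = mu A) -> coupling m (quantize n m) pi ->
  (\int[mu]_x `|x - qmap mu n setT x|%:E <= \int[pi]_z `|z.1 - z.2|%:E)%E.
Proof.
move=> mE piE; set q := qmap mu n setT; set h := potential n setT.
have mT : 0 < mass mu setT by rewrite mass_setT.
have mq : measurable_fun setT q by exact: measurable_qmap.
have mh : measurable_fun setT (EFin \o h).
  by apply/measurable_EFinP; exact: measurable_potential.
have fstE A : measurable A -> mu A = pi (fst @^-1` A).
  by move=> mA; have [-> _] := piE _ mA; rewrite mE.
have sndE A : measurable A -> pushforward mu q A = pi (snd @^-1` A).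
  move=> mA; have [_ ->] := piE _ mA.
  rewrite (quantizeE imu n measurableT mT _ mA); last exact: is_conditional_setT.
  rewrite setTI mass_setT divr1 -massE//.
  by rewrite -[_ @^-1` A]setTI; exact: mq.
have ih : mu.-integrable setT (EFin \o h) by exact: integrable_potential.
(* The potential identity writes [h (q x)] as a difference of two integrable functions. *)
have ihq : mu.-integrable setT (fun x => (h (q x))%:E).
  apply: (eq_integrable measurableT
    (fun x => ((h x)%:E - `|x - q x|%:E)%E)).
    by move=> x _; rewrite -(potential_qmap n x measurableT mT) -EFinB subKr.
  by apply: integrableB => //; exact: integrable_dist_qmap.
have ih1 : pi.-integrable setT (fun z => (h z.1)%:E).
  exact: (integrable_image measurable_fst fstE mh).
have ih2 : pi.-integrable setT (fun z => (h z.2)%:E).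
  apply: (integrable_image measurable_snd sndE mh).
  exact: (image_integrable mq (fun _ _ => erefl) mh).
have -> : (\int[mu]_x `|x - q x|%:E =
    \int[pi]_z ((h z.1)%:E - (h z.2)%:E))%E.
  rewrite integralB// -(integral_image measurable_fst fstE mh).
  rewrite -(integral_image measurable_snd sndE mh).
  rewrite (integral_image mq (fun _ _ => erefl) mh) -integralB//.
  by apply: eq_integral => x _; rewrite -EFinB (potential_qmap n x measurableT mT).
(* A finite cost supplies the integrability that monotonicity of the integral asks for; an infinite
   cost is trivial. *)
have [fin|] := ltP (\int[pi]_z `|z.1 - z.2|%:E)%E +oo%E; last first.
  by rewrite leye_eq => /eqP ->; rewrite leey.
apply: le_integral => //; first exact: integrableB.
  apply/integrableP; split; first exact: measurable_dist12.
  by under eq_integral do rewrite gee0_abs ?lee_fin//.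
move=> z _; rewrite -EFinB lee_fin; apply: le_trans (ler_norm _) _.
exact: potential_lip.
Qed.

End quantization_error.

(** * Quantization and compression of random variables *)

Lemma measurable_final_cells (R : realType) n (m : set R -> \bar R) (C : set R) :
  C \in final_cells n m -> measurable C.
Proof.
elim: n m C => [|n IHn] m C /=; first by rewrite inE => /eqP ->.
case: splits; last by rewrite inE => /eqP ->.
rewrite mem_cat => /orP[] /mapP[B /IHn mB ->]; apply: measurableI => //;
  [exact: measurable_above_set|exact: measurable_below_set].
Qed.

Lemma measurable_quantize_rv d (T : measurableType d) (R : realType)
    (P : probability T R) n (X : T -> R) :
  measurable_fun setT X -> measurable_fun setT (quantize_rv P n X).
Proof.
move=> mX.
(* Measurability of a sum is asked for every index, so a set outside the list of cells is replaced
   by the empty set. *)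
have -> : quantize_rv P n X = fun w => \sum_(C <- final_cells n (law P X))
    \1_(if C \in final_cells n (law P X) then C else set0) (X w) *
    cond_expectation P X C.
  apply/funext => w; rewrite /quantize_rv [LHS]big_seq [RHS]big_seq.
  by apply: eq_bigr => C ->.
apply: measurable_sum => C; apply: measurable_funM; last exact: measurable_cst.
apply: measurableT_comp mX; case: ifPn => [CE|_].
  by apply: measurable_indic; exact: measurable_final_cells CE.
exact: measurable_indic.
Qed.

Section quantized_variable.
Context d (T : measurableType d) (R : realType) (P : probability T R).
Variable X : {mfun T >-> R}.
Hypothesis iX : P.-integrable setT (fun w => (X w)%:E).
Local Notation mu := (distribution P X : probability R R).

Let mT : 0 < mass mu setT.
Proof. by rewrite mass_setT. Qed.

Let muE (A : set R) : measurable A -> mu A = P (X @^-1` A).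
Proof. by []. Qed.

Lemma integrable_distribution : mu.-integrable setT (fun x => x%:E).
Proof.
apply: (image_integrable (X := X) _ muE) => //.
by apply/measurable_EFinP; exact: measurable_id.
Qed.

Lemma centre_distribution (C : set R) : measurable C ->
  centre mu C = cond_expectation P X C.
Proof.
move=> mC; rewrite /centre /cond_expectation; congr (_ / _).
rewrite /Rintegral integral_pushforward//.
by apply: integrableS iX => //; rewrite -[_ @^-1` _]setTI; exact: measurable_funP.
Qed.

Lemma quantize_rvE n w : quantize_rv P n X w = qmap mu n setT (X w).
Proof.
have lawE : is_conditional mu setT (law P X) by exact: is_conditional_setT.
rewrite -(sum_final_cells integrable_distribution n (X w) measurableT mT lawE).
rewrite /quantize_rv [LHS]big_seq [RHS]big_seq; apply: eq_bigr => C CE.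
by rewrite setTI centre_distribution//; exact: measurable_final_cells CE.
Qed.

Lemma integral_dist_quantize_rv n :
  (\int[P]_w `|X w - quantize_rv P n X w|%:E =
   \int[mu]_x `|x - qmap mu n setT x|%:E)%E.
Proof.
rewrite (ge0_integral_image (X := X) _ muE)//; last first.
  by apply/measurable_EFinP; exact: measurable_dist_qmap.
by apply: eq_integral => w _; rewrite quantize_rvE.
Qed.

Lemma quantize_rv_le_wasserstein n (m : set R -> \bar R) :
  (forall A, measurable A -> law P X A = m A) ->
  (\int[P]_w `|X w - quantize_rv P n X w|%:E <=
   wasserstein1 m (quantize n m))%E.
Proof.
move=> mE; rewrite integral_dist_quantize_rv; apply/ereal_infP => _ [pi piE <-].
by apply: (qmap_optimal integrable_distribution _ piE) => A /mE <-.
Qed.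

(** Each value is taken on a cell of positive mass, hence lies in the support. The bound therefore
    holds at all sample points, not only almost surely. *)
Lemma quantize_rv_diam n (m : set R -> \bar R) :
  (forall A, measurable A -> law P X A = m A) -> forall w w',
  (`|quantize_rv P n X w - quantize_rv P n X w'|%:E <=
   diam (msupport (quantize n m)))%E.
Proof.
move=> mE w w'; apply: ereal_sup_ubound.
suff sQ v : msupport (quantize n m) (quantize_rv P n X v).
  by exists (quantize_rv P n X w) => //; exists (quantize_rv P n X w').
move=> U oU; rewrite quantize_rvE => UQ.
have mE' A : measurable A -> m A = mu A by move=> /mE.
rewrite (quantizeE integrable_distribution n measurableT mT
  (is_conditional_setT mE') (open_measurable oU)).
rewrite setTI mass_setT divr1 lte_fin.
have [B [mB _ B0 _ qB]] :=
  qmap_cell n (X v) measurableT mT.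
apply: (lt_le_trans B0); apply: le_mass => //.
  by rewrite -[_ @^-1` U]setTI; exact: measurable_qmap (open_measurable oU).
by move=> y /qB /= ->.
Qed.

Lemma centre_rv_range (B : set R) (a b : R) : measurable B -> 0 < mass mu B ->
  (forall w, a <= X w <= b) -> a <= centre mu B <= b.
Proof.
move=> mB B0 abX; rewrite centre_distribution// /cond_expectation.
have mXB : measurable (X @^-1` B).
  by rewrite -[_ @^-1` _]setTI; exact: measurable_funP.
have iXB : P.-integrable (X @^-1` B) (EFin \o X) by exact: integrableS iX.
have icB r : P.-integrable (X @^-1` B) (EFin \o cst r).
  by exact: finite_measure_integrable_cst.
rewrite ler_pdivlMr// ler_pdivrMr// -!(Rintegral_cst P mXB).
by apply/andP; split; apply: le_Rintegral;
  do ?[exact: icB|exact: iXB|by move=> v _; have /andP[] := abX v].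
Qed.

Section bounded.
Variable D : R.
Hypothesis XD : forall w w', `|X w - X w'| <= D.

Lemma centre_bounded (B : set R) w : measurable B -> 0 < mass mu B ->
  X w - D <= centre mu B <= X w + D.
Proof.
move=> mB B0; apply: centre_rv_range => // v.
by have := XD v w; rewrite ler_norml; lra.
Qed.

(** Both values are conditional means of [X]. Every value of [X] is within [D] of the first mean,
    and hence so is the second, being an average of such values. *)
Lemma quantize_rv_oscillation n w w' :
  `|quantize_rv P n X w - quantize_rv P n X w'| <= D.
Proof.
rewrite !quantize_rvE.
have [B [mB _ B0 <- _]] := qmap_cell n (X w) measurableT mT.
have [B' [mB' _ B0' <- _]] := qmap_cell n (X w') measurableT mT.
have : centre mu B - D <= centre mu B' <= centre mu B + D.
  apply: centre_rv_range => // v.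
  by have := centre_bounded v mB B0; lra.
by rewrite ler_norml; lra.
Qed.

(** All values of [X] lie within [D] of a fixed one [X w]. With [a = X w - D] and [b = X w + D] the
    product under the root is [D ^+ 2 - (c - X w) ^+ 2]. *)
Lemma quantize_rv_bounded_error n :
  (\int[P]_w `|X w - quantize_rv P n X w|%:E <= ((2 ^+ n)^-1 * D)%:E)%E.
Proof.
rewrite integral_dist_quantize_rv.
have [w _] := probability_inhabited P.
have h := integral_dist_qmap integrable_distribution n (a := X w - D) (b := X w + D)
  measurableT mT (fun B mB _ B0 => centre_bounded w mB B0).
have D0 : 0 <= D by apply: le_trans (XD w w).
rewrite -[leLHS]fineK; last first.
  apply: integrable_fin_num => //.
  exact: integrable_dist_qmap integrable_distribution _ _.
rewrite lee_fin; apply: le_trans h _; rewrite mass_setT mul1r.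
rewrite ler_wpM2l ?invr_ge0 ?exprn_ge0//.
have /andP[c1 c2] := centre_bounded w measurableT mT.
rewrite -ler_sqr ?nnegrE ?sqrtr_ge0// sqr_sqrtr; last first.
  by rewrite mulr_ge0; lra.
set c := centre _ _ in c1 c2 *.
by have := sqr_ge0 (c - X w); lra.
Qed.

End bounded.
End quantized_variable.

Lemma compress_rv_spec d (T : measurableType d) (R : realType)
    (P : probability T R) n (Z : T -> R) (D : \bar R) :
  measurable_fun setT Z -> (forall w w', `|Z w - Z w'|%:E <= D)%E ->
  [/\ measurable_fun setT (compress_rv P n Z),
    (forall w w', `|compress_rv P n Z w - compress_rv P n Z w'|%:E <= D)%E &
    (\int[P]_w `|Z w - compress_rv P n Z w|%:E <= ((2 ^+ n)^-1)%:E * D)%E].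
Proof.
move=> mZ ZD; have [w _] := probability_inhabited P.
have D0 : (0 <= D)%E by apply: le_trans (ZD w w); rewrite lee_fin.
have n0 : 0 < (2 ^+ n)^-1 :> R by rewrite invr_gt0 exprn_gt0.
rewrite /compress_rv; case: ifP => _; last first.
  split=> //; rewrite integral0_eq; first by rewrite mule_ge0// lee_fin ltW.
  by move=> v _; rewrite subrr normr0.
(* For infinite [D] the bounds are trivial, since the factor of [D] is positive; a finite [D] makes
   [Z] bounded, hence integrable. *)
case: D D0 ZD => [r| |] // _ ZD; last first.
  split; first exact: measurable_quantize_rv.
    by move=> v v'; rewrite leey.
  by rewrite gt0_muley ?leey// lte_fin.
pose Z' : {mfun T >-> R} := mfun_Sub (mem_set mZ).
have Zr v v' : `|Z' v - Z' v'| <= r by rewrite -lee_fin ZD.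
have iZ : P.-integrable setT (fun w => (Z' w)%:E).
  apply: (@le_integrable _ _ _ _ _ measurableT _ (cst (`|Z w| + r)%:E)).
  - exact/measurable_EFinP.
  - move=> v _; rewrite lee_fin; apply: le_trans (ler_norm _).
    rewrite addrC -lerBlDr; apply: le_trans (lerB_dist _ _) _; exact: Zr.
  - exact: finite_measure_integrable_cst.
split; first exact: measurable_quantize_rv.
  by move=> v v'; rewrite lee_fin (quantize_rv_oscillation iZ Zr).
by rewrite -EFinM; exact: (quantize_rv_bounded_error iZ Zr).
Qed.

(** * Lipschitz functions *)

Section lipschitz_functions.
Context (R : realType) (A : finType) (f : (A -> R) -> R).
Implicit Types x y : A -> R.

Lemma dist1_ge0 x y : 0 <= dist1 x y.
Proof. by apply: sumr_ge0 => a _; exact: normr_ge0. Qed.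

Lemma dist1_eq0 x y : dist1 x y = 0 -> x = y.
Proof.
move=> /eqP; rewrite psumr_eq0; last by move=> a _; exact: normr_ge0.
move=> /allP xy; apply/funext => a; apply/eqP.
by have := xy a; rewrite mem_index_enum/= normr_eq0 subr_eq0; apply.
Qed.

Lemma lip_norm_ge0 : 0 <= lip_norm f.
Proof.
(* A set without supremum has [sup] equal to 0 by default. *)
have [[[r fr] ub]|] := pselect (has_sup [set r : R | exists x y, x <> y /\
    r = `|f x - f y| / dist1 x y]); last by move=> /sup_out; rewrite -/(lip_norm f) => ->.
apply: (@le_trans _ _ r); last exact: ub_le_sup.
by case: fr => x [y [_ ->]]; rewrite divr_ge0// dist1_ge0.
Qed.

Hypothesis lf : globally_lipschitz f.

Lemma lip_normP x y : `|f x - f y| <= lip_norm f * dist1 x y.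
Proof.
have [->|xy] := pselect (x = y).
  rewrite subrr normr0; apply: mulr_ge0; first exact: lip_norm_ge0.
  exact: dist1_ge0.
have d0 (u v : A -> R) : u <> v -> 0 < dist1 u v.
  move=> uv; rewrite lt_neqAle dist1_ge0 andbT eq_sym.
  by apply/eqP => /dist1_eq0.
rewrite -ler_pdivrMr; last exact: d0.
apply: ub_le_sup; last by exists x, y.
have [k fk] := lf; exists k => _ [u [v [uv ->]]].
by rewrite ler_pdivrMr ?fk ?d0.
Qed.

(* McShane's formula: [f y] is the infimum over rational points [q] of
   [f q + lip_norm f * dist1 y q]. *)
Lemma measurable_lipschitz_comp d (T : measurableType d) (Y : A -> T -> R) :
  (forall a, measurable_fun setT (Y a)) ->
  measurable_fun setT (fun w => f (fun a => Y a w)).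
Proof.
move=> mY; pose L := lip_norm f; have L0 : 0 <= L := lip_norm_ge0.
pose pt (q : {ffun A -> rat}) : A -> R := fun a => ratr (q a).
pose F q w := f (pt q) + L * dist1 (fun a => Y a w) (pt q).
have mF q : measurable_fun setT (F q).
  apply: measurable_funD; first exact: measurable_cst.
  apply: measurable_funM; first exact: measurable_cst.
  apply: measurable_sum => a; apply: measurableT_comp => //.
  by apply: measurable_funB => //; exact: measurable_cst.
move=> mT; apply: (measurability _ (RGenInftyO.measurableE R)) => //.
move=> _ [_ [c ->] <-]; rewrite setTI.
rewrite (_ : _ @^-1` _ = \bigcup_q (F q @^-1` `]-oo, c[)).
  apply: countable_bigcupT_measurable => [|q]; first exact: countableP.
  by rewrite -[_ @^-1` _]setTI; apply: mF => //; exact: measurable_itv.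
apply/seteqP; split => w /=; last first.
  move=> [q _] /=; rewrite !in_itv/=; apply: le_lt_trans; rewrite /F.
  have := lip_normP (fun a => Y a w) (pt q); rewrite ler_norml -/L.
  by move=> /andP[_]; rewrite lerBlDl.
rewrite in_itv/= => fc; set y := fun a => Y a w in fc *.
(* Coordinates within [e] put the expression at most [2 * L * #|A| * e] above [f y], that is, at
   most [c - e]. The added 1 makes [K] positive and the inequality strict. *)
pose K := 2 * L * #|A|%:R + 1.
have K0 : 0 < K by rewrite ltr_pwDr// !mulr_ge0.
pose e := (c - f y) / K.
have e0 : 0 < e by rewrite divr_gt0// subr_gt0.
have near_rat a : exists q : rat, `|y a - ratr q| <= e.
  have [q] := @rat_in_itvoo R (y a) (y a + e) ltac:(by rewrite ltrDl).
  rewrite in_itv/= => /andP[yq qe]; exists q.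
  by rewrite distrC ler_norml; lra.
have [q0 q0E] := choice near_rat.
exists [ffun a => q0 a] => //=; rewrite in_itv/= /F -/y.
set p := pt _.
have dp : dist1 y p <= #|A|%:R * e.
  rewrite mulr_natl -sumr_const; apply: ler_sum => a _.
  by rewrite /p /pt ffunE.
have := lip_normP y p; rewrite ler_norml -/L => /andP[h _].
have Ld : L * dist1 y p <= L * (#|A|%:R * e) by rewrite ler_wpM2l.
have eE : K * e = c - f y by rewrite mulrC divfK// gt_eqF.
by move: eE; rewrite /K; lra.
Qed.

Lemma expected_lipschitz d (T : measurableType d) (P : probability T R)
    (Y Y' : A -> T -> R) :
  (forall a, measurable_fun setT (Y a)) ->
  (forall a, measurable_fun setT (Y' a)) ->
  (\int[P]_w `|f (fun a => Y a w) - f (fun a => Y' a w)|%:E <=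
   (lip_norm f)%:E * \sum_a \int[P]_w `|Y a w - Y' a w|%:E)%E.
Proof.
move=> mY mY'.
have mYY' a : measurable_fun setT (fun w => `|Y a w - Y' a w|%:E).
  by apply/measurable_EFinP; apply: measurableT_comp => //; exact: measurable_funB.
rewrite -ge0_integral_sum// -ge0_integralZl//; last 3 first.
- exact: emeasurable_sum.
- by move=> w _; apply: sume_ge0 => a _; rewrite lee_fin.
- by rewrite lee_fin lip_norm_ge0.
apply: ge0_le_integral => //.
- apply/measurable_EFinP; apply: measurableT_comp => //.
  by apply: measurable_funB; [exact: (measurable_lipschitz_comp mY)|
    exact: (measurable_lipschitz_comp mY')].
- by apply: measurable_funeM; exact: emeasurable_sum.
- by move=> w _; rewrite sumEFin -EFinM lee_fin lip_normP.
Qed.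

End lipschitz_functions.

(** * Directed paths *)

Section paths.
Context (V : finType) (E : rel V).
Implicit Types (s u v : V) (p : seq V).

Lemma path_edges_rcons u p v :
  path_edges u (rcons p v) = rcons (path_edges u p) (last u p, v).
Proof.
by elim: p u => [|x p IHp] u //; rewrite /path_edges /= -/(path_edges _ _) IHp.
Qed.

Lemma dipaths_rcons s v p : p != [::] -> dipaths E s v p ->
  exists (u : {u | u \in in_nbr E v}) p',
    p = rcons p' v /\ dipaths E s (val u) p'.
Proof.
case/lastP: p => [//|p x] _ [/= + +]; rewrite rcons_path last_rcons.
move=> /andP[sp Epx] xv; rewrite xv in Epx *.
have uv : last s p \in in_nbr E v by rewrite inE.
by exists (exist (fun u => u \in in_nbr E v) _ uv), p.
Qed.

Lemma rcons_dipaths s v (u : {u | u \in in_nbr E v}) p :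
  dipaths E s (val u) p -> dipaths E s v (rcons p v).
Proof.
move=> [sp pu]; split; last by rewrite last_rcons.
by rewrite rcons_path sp pu; have := valP u; rewrite inE.
Qed.

Definition extend_paths v (l : V -> seq (seq V)) : seq (seq V) :=
  [seq rcons p v | u : {u | u \in in_nbr E v} <- enum {: {u | u \in in_nbr E v}},
    p : seq V <- l (val u)].

(** The penultimate vertex can be read off an extended path, so paths through different
    in-neighbours differ. *)
Lemma uniq_extend_paths s v l :
  (forall u : {u | u \in in_nbr E v},
     uniq (l (val u)) /\ [set` l (val u)] = dipaths E s (val u)) ->
  uniq (extend_paths v l).
Proof.
move=> lP; apply: allpairs_uniq_dep.
- exact: enum_uniq.
- by move=> u _; case: (lP u).
move=> [u p] [u' p'] /allpairsPdep[x [y [_ yl [-> ->]]]].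
move=> /allpairsPdep[x' [y' [_ yl' [-> ->]]]] /= /rcons_inj[yy'].
have lastE (z : {u | u \in in_nbr E v}) t : t \in l (val z) -> last s t = val z.
  move=> tl; have [_ lE] := lP z.
  by have : [set` l (val z)] t by []; rewrite lE => -[].
have xx' : x = x' by apply: val_inj; rewrite -(lastE _ _ yl) -(lastE _ _ yl') yy'.
by rewrite yy' xx'.
Qed.

(** Well-founded induction along the edges. The finiteness obtained makes the sums over [dipaths]
    genuine, as a sum with infinite support defaults to 0. *)
Lemma dipaths_list : acyclic E ->
  forall s v, exists l, uniq l /\ [set` l] = dipaths E s v.
Proof.
move=> /acyclic_wf wfE s; elim/(well_founded_ind wfE) => v IHv.
have lP (u : {u | u \in in_nbr E v}) :
    exists l, uniq l /\ [set` l] = dipaths E s (val u).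
  by apply: IHv; have := valP u; rewrite inE.
have [l' l'P] := choice lP.
pose l u := if insub u is Some u' then l' u' else [::].
have lE (u : {u | u \in in_nbr E v}) :
    uniq (l (val u)) /\ [set` l (val u)] = dipaths E s (val u).
  by rewrite /l valK; exact: l'P.
exists ((if s == v then [:: [::]] else [::]) ++ extend_paths v l); split.
  rewrite cat_uniq (uniq_extend_paths lE) andbT; apply/andP; split.
    by case: ifP.
  case: ifP => _; last by apply/hasPn.
  by apply/hasPn => q /allpairsPdep[u [p [_ _ ->]]]; rewrite inE; case: p.
apply/seteqP; split => p; rewrite /= mem_cat.
  move=> /orP[|/allpairsPdep[u [q [_ ql ->]]]].
    by case: eqP => // -> /[!inE]/eqP ->.
  by apply: (rcons_dipaths (u := u)); have : [set` l (val u)] q by []; case: (lE u) => _ ->.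
have [->|p0] := eqVneq p [::].
  by move=> [_ /= ->]; rewrite eqxx inE eqxx.
move=> /(dipaths_rcons p0)[u [q [-> qd]]]; apply/orP; right.
apply/allpairsPdep; exists u, q; split=> //; first by rewrite mem_enum.
by move: qd; case: (lE u) => _ <-.
Qed.

Section path_sums.
Context (R : realType).
Implicit Type F : seq V -> \bar R.

Lemma dipaths_sum_source s F : acyclic E -> (forall p, 0 <= F p)%E ->
  (F [::] <= \sum_(p \in dipaths E s s) F p)%E.
Proof.
move=> acE F0; have [l [ul lE]] := dipaths_list acE s s.
rewrite -lE -fsbig_seq// (big_rem [::])/=; first by rewrite leeDl// sume_ge0.
by have : [set` l] [::]; [rewrite lE|].
Qed.

(** As [s != v] excludes the empty path, each path splits uniquely into a path to an in-neighbour of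
    [v] and a last edge. *)
Lemma dipaths_sum_rcons s v F : acyclic E -> s != v ->
  (\sum_(p \in dipaths E s v) F p =
   \sum_(u : {u | u \in in_nbr E v})
      \sum_(p \in dipaths E s (val u)) F (rcons p v))%E.
Proof.
move=> acE sv; have [l lE] := choice (dipaths_list acE s).
transitivity (\sum_(p <- extend_paths v l) F p)%E.
  rewrite [RHS]fsbig_seq; last by apply: (uniq_extend_paths (s := s)) => u; exact: lE.
  apply: eq_fsbigl => //; apply/seteqP; split => p /=.
    move=> dp; have p0 : p != [::].
      by apply: contra_neq sv => p0; move: dp; rewrite p0 => -[].
    have [u [q [-> qd]]] := dipaths_rcons p0 dp.
    apply/allpairsPdep; exists u, q; split=> //; first by rewrite mem_enum.
    by move: qd; case: (lE (val u)) => _ <-.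
  move=> /allpairsPdep[u [q [_ ql ->]]]; apply: (rcons_dipaths (u := u)).
  have : [set` l (val u)] q by [].
  by case: (lE (val u)) => _ ->.
rewrite big_allpairs_dep /= big_enum /=; apply: eq_bigr => u _.
by have [ul <-] := lE (val u); rewrite -fsbig_seq.
Qed.

End path_sums.
End paths.

(** * Recursions for the sums over paths *)

(** The algebra of lengthening a path by an edge with constant [L]. The signs are needed to
    distribute over extended reals, as [b] and [D] may be infinite. *)
Lemma weighted_error_step (R : realType) (b D : \bar R) (c1 c2 L W : R) :
  (0 <= b)%E -> (0 <= D)%E -> 0 <= c1 -> 0 <= c2 ->
  ((b + (c1 + c2)%R%:E * D) * (L * W)%R%:E =
   L%:E * ((b + c1%:E * D) * W%:E) + c2%:E * (L%:E * (D * W%:E)))%E.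
Proof.
move=> b0 D0 c10 c20.
have c1D : (0 <= c1%:E * D)%E by apply: mule_ge0.
have c2D : (0 <= c2%:E * D)%E by apply: mule_ge0.
have -> : ((c1 + c2)%R%:E * D = c1%:E * D + c2%:E * D)%E.
  by rewrite EFinD ge0_muleDl// lee_fin.
rewrite addeA ge0_muleDl//; last exact: adde_ge0.
rewrite EFinM; congr (_ + _)%E; first by rewrite muleCA.
by rewrite -muleA (muleCA D).
Qed.

Section path_bounds.
Context (R : realType) (V : finType) (E : rel V).
Context (f : forall v : V, ({u : V | u \in in_nbr E v} -> R) -> R).
Hypothesis acE : acyclic E.
Local Notation source := {s : V | s \in sources E}.
Context (n : nat) (b D : source -> \bar R).
Hypotheses (b0 : forall s, (0 <= b s)%E) (D0 : forall s, (0 <= D s)%E).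
Implicit Types (s : source) (v : V) (p : seq V).

Definition path_weight s p : R :=
  \prod_(e <- path_edges (val s) p) lip_norm (f (v := e.2)).

(** The summand of the theorem, with [b] and [D] in place of the Wasserstein error and the diameter
    at the source. *)
Definition path_error s p : \bar R :=
  ((b s + (3 * (size (path_edges (val s) p))%:R / 2 ^+ n)%R%:E * D s) *
   (path_weight s p)%:E)%E.

(** The oscillation [D s] at the source, as amplified by the Lipschitz constants along [p]. *)
Definition path_oscillation s p : \bar R := (D s * (path_weight s p)%:E)%E.

Definition path_sum (F : source -> seq V -> \bar R) v : \bar R :=
  (\sum_(s : source) \sum_(p \in dipaths E (val s) v) F s p)%E.

Lemma path_weight_ge0 s p : 0 <= path_weight s p.
Proof. by apply: prodr_ge0 => e _; exact: lip_norm_ge0. Qed.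

Lemma path_weight_rcons s p v :
  path_weight s (rcons p v) = lip_norm (f (v := v)) * path_weight s p.
Proof. by rewrite /path_weight path_edges_rcons big_rcons /= mulrC. Qed.

Lemma path_oscillation_ge0 s p : (0 <= path_oscillation s p)%E.
Proof. by rewrite mule_ge0// lee_fin path_weight_ge0. Qed.

Lemma path_error_ge0 s p : (0 <= path_error s p)%E.
Proof.
by rewrite mule_ge0 ?lee_fin ?path_weight_ge0// adde_ge0// mule_ge0// lee_fin.
Qed.

Lemma path_oscillation_rcons s p v : path_oscillation s (rcons p v) =
  ((lip_norm (f (v := v)))%:E * path_oscillation s p)%E.
Proof. by rewrite /path_oscillation path_weight_rcons EFinM muleCA. Qed.

(** One more edge multiplies the weight by a Lipschitz constant and adds 1 to the length, which
    contributes [3 / 2 ^+ n] times the oscillation of the longer path. *)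
Lemma path_error_rcons s p v : path_error s (rcons p v) =
  ((lip_norm (f (v := v)))%:E * path_error s p +
   ((3 / 2 ^+ n)%R%:E * ((lip_norm (f (v := v)))%:E * path_oscillation s p)))%E.
Proof.
rewrite /path_error /path_oscillation path_weight_rcons path_edges_rcons.
rewrite size_rcons; set k := size _.
have -> : 3 * k.+1%:R / 2 ^+ n = 3 * k%:R / 2 ^+ n + 3 / 2 ^+ n :> R.
  by rewrite -[k.+1%:R]natr1 mulrDr mulr1 mulrDl.
by rewrite weighted_error_step// divr_ge0 ?exprn_ge0 ?mulr_ge0.
Qed.

Lemma path_sum_ge0 F v : (forall s p, 0 <= F s p)%E -> (0 <= path_sum F v)%E.
Proof. by move=> F0; apply: sume_ge0 => s _; exact: fsume_ge0. Qed.

Lemma path_sum_source F s : (forall s p, 0 <= F s p)%E ->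
  (F s [::] <= path_sum F (val s))%E.
Proof.
move=> F0; apply: le_trans (dipaths_sum_source (val s) acE (F0 s)) _.
rewrite /path_sum (bigD1 s)//= leeDl// sume_ge0// => s' _; exact: fsume_ge0.
Qed.

Lemma path_sum_rcons F v : v \notin sources E -> path_sum F v =
  (\sum_(u : {u | u \in in_nbr E v}) path_sum (fun s p => F s (rcons p v)) (val u))%E.
Proof.
move=> vS; rewrite /path_sum exchange_big /=; apply: eq_bigr => s _.
by apply: dipaths_sum_rcons => //; apply: contraNneq vS => <-; exact: valP.
Qed.

Lemma path_sumZ F (k : \bar R) v : (0 <= k)%E -> (forall s p, 0 <= F s p)%E ->
  path_sum (fun s p => k * F s p)%E v = (k * path_sum F v)%E.
Proof.
move=> k0 F0; rewrite /path_sum ge0_sume_distrr; last first.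
  by move=> s _; exact: fsume_ge0.
by apply: eq_bigr => s _; rewrite ge0_mule_fsumr.
Qed.

Lemma path_sumD F G v :
  path_sum (fun s p => F s p + G s p)%E v = (path_sum F v + path_sum G v)%E.
Proof.
rewrite /path_sum -big_split /=; apply: eq_bigr => s _.
have [l [_ lE]] := dipaths_list acE (val s) v.
by rewrite fsbig_split// -lE; exact: finite_seq.
Qed.

Lemma path_sum_oscillation v : v \notin sources E ->
  path_sum path_oscillation v =
  ((lip_norm (f (v := v)))%:E *
   \sum_(u : {u | u \in in_nbr E v}) path_sum path_oscillation (val u))%E.
Proof.
move=> vS; rewrite path_sum_rcons// ge0_sume_distrr; last first.
  by move=> u _; exact: path_sum_ge0 path_oscillation_ge0.
apply: eq_bigr => u _; rewrite -path_sumZ ?lee_fin ?lip_norm_ge0//; last first.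
  exact: path_oscillation_ge0.
apply: eq_bigr => s _; apply: eq_fsbigr => p _; exact: path_oscillation_rcons.
Qed.

(** Mirrors the error recursion of the network: errors propagated from the in-neighbours, plus a
    multiple of the oscillation bound at [v] that will absorb the compression error. *)
Lemma path_sum_error v : v \notin sources E ->
  path_sum path_error v =
  ((lip_norm (f (v := v)))%:E *
     \sum_(u : {u | u \in in_nbr E v}) path_sum path_error (val u) +
   (3 / 2 ^+ n)%R%:E * path_sum path_oscillation v)%E.
Proof.
move=> vS; have L0 : (0 <= (lip_norm (f (v := v)))%:E)%E.
  by rewrite lee_fin lip_norm_ge0.
have n0 : (0 <= (3 / 2 ^+ n)%R%:E :> \bar R)%E.
  by rewrite lee_fin divr_ge0 ?exprn_ge0.
rewrite [in LHS]path_sum_rcons// path_sum_oscillation//.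
rewrite ge0_sume_distrr; last by move=> u _; exact: path_sum_ge0 path_error_ge0.
rewrite !ge0_sume_distrr; last 2 first.
- move=> u _; apply: mule_ge0 => //; exact: path_sum_ge0 path_oscillation_ge0.
- by move=> u _; exact: path_sum_ge0 path_oscillation_ge0.
rewrite -big_split /=; apply: eq_bigr => u _.
have Lo s p : (0 <= (lip_norm (f (v := v)))%:E * path_oscillation s p)%E.
  by apply: mule_ge0 => //; exact: path_oscillation_ge0.
rewrite -(path_sumZ _ L0 path_error_ge0) -(path_sumZ _ L0 path_oscillation_ge0).
rewrite -(path_sumZ _ n0 Lo) -path_sumD.
by apply: eq_bigr => s _; apply: eq_fsbigr => p _; exact: path_error_rcons.
Qed.

End path_bounds.

(** * Coupling on the sample space and proof of the theorem *)

(** The joint law of [Y] and [Z] is one of the couplings in the infimum. *)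
Lemma wasserstein1_le_expectation d (T : measurableType d) (R : realType)
    (P : probability T R) (Y Z : T -> R) :
  measurable_fun setT Y -> measurable_fun setT Z ->
  (wasserstein1 (law P Y) (law P Z) <= \int[P]_w `|Y w - Z w|%:E)%E.
Proof.
move=> mY mZ; have mYZ : measurable_fun setT (fun w => (Y w, Z w)).
  exact: measurable_fun_pair.
pose YZ : {mfun T >-> (R * R)%type} := mfun_Sub (mem_set mYZ).
apply: ereal_inf_lbound; exists (distribution P YZ); first by [].
by rewrite (ge0_integral_image mYZ (fun _ _ => erefl))//; exact: measurable_dist12.
Qed.

Lemma dist_integral_triangle d (T : measurableType d) (R : realType)
    (P : probability T R) (X Y Z : T -> R) :
  measurable_fun setT X -> measurable_fun setT Y -> measurable_fun setT Z ->
  (\int[P]_w `|X w - Z w|%:E <=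
   \int[P]_w `|X w - Y w|%:E + \int[P]_w `|Y w - Z w|%:E)%E.
Proof.
move=> mX mY mZ.
have md (A B : T -> R) : measurable_fun setT A -> measurable_fun setT B ->
    measurable_fun setT (fun w => `|A w - B w|%:E).
  move=> mA mB; apply/measurable_EFinP; apply: measurableT_comp => //.
  exact: measurable_funB.
rewrite -ge0_integralD//; [|exact: md|exact: md].
apply: ge0_le_integral => //; first exact: md.
  by apply: emeasurable_funD; exact: md.
by move=> w _; rewrite -EFinD lee_fin; exact: ler_distD.
Qed.

Theorem theorem1p1 (R : realType) (V : finType) (E : rel V) (Delta : V)
  (f : forall v : V, ({u : V | u \in in_nbr E v} -> R) -> R)
  (mu : {s : V | s \in sources E} -> probability R R)
  (d : measure_display) (T : measurableType d) (P : probability T R)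
  (X : {s : V | s \in sources E} -> {RV P >-> R})
  (Y Yc : V -> T -> R) (n : nat)
  (hG : computational_graph E Delta)
  (hf : forall v : V, v \notin sources E -> globally_lipschitz (f v))
  (hmu : forall s, (mu s).-integrable [set: R] (fun t : R => t%:E))
  (hindep : mutually_independent P (fun s w => X s w))
  (hlaw : forall s (A : set R), measurable A -> law P (X s) A = mu s A)
  (hn : (1 <= n)%N)
  (hY : is_dcg f (fun s => X s) Y)
  (hYc : is_cqdcg P f n (fun s => X s) Yc) :
  (wasserstein1 (law P (Y Delta)) (law P (Yc Delta)) <=
   \sum_(s : {s : V | s \in sources E})
     \sum_(p \in dipaths E (val s) Delta)
       (wasserstein1 (mu s) (quantize n (mu s)) +
        (3 * (size (path_edges (val s) p))%:R / 2 ^+ n)%R%:E *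
          diam (msupport (quantize n (mu s)))) *
       (\prod_(e <- path_edges (val s) p) lip_norm (f e.2))%R%:E)%E.
Proof.
have acE := hG.1.
pose b s := wasserstein1 (mu s) (quantize n (mu s)).
pose D s := diam (msupport (quantize n (mu s))).
have iX s : P.-integrable setT (fun w => (X s w)%:E).
  apply: (integrable_image (X := X s) (nu := mu s)) => // A mA.
  by rewrite -hlaw.
have [w0 _] := probability_inhabited P.
have b0 s : (0 <= b s)%E.
  apply: le_trans (quantize_rv_le_wasserstein (iX s) n (hlaw s)).
  exact: integral_ge0.
have D0 s : (0 <= D s)%E.
  by apply: le_trans (quantize_rv_diam (iX s) n (hlaw s) w0 w0); rewrite lee_fin.
have po_ge0 := path_oscillation_ge0 f D0.
have pe_ge0 := path_error_ge0 f n b0 D0.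
(* The induction along edges carries the oscillation of [Yc] besides the error, since it controls
   the compression error at later vertices. *)
pose spec v := [/\ measurable_fun setT (Y v), measurable_fun setT (Yc v),
  (forall w w', `|Yc v w - Yc v w'|%:E <=
     path_sum (path_oscillation f D) v)%E &
  (\int[P]_w `|Y v w - Yc v w|%:E <= path_sum (path_error f n b D) v)%E].
suff specP v : spec v.
  have [mY mYc _ err] := specP Delta.
  exact: le_trans (wasserstein1_le_expectation P mY mYc) err.
elim/(well_founded_ind (acyclic_wf acE)): v => v IHv.
have [vS|vS] := boolP (v \in sources E).
  pose s : {s : V | s \in sources E} := exist _ v vS.
  have -> : v = val s by [].
  rewrite /spec hY.1 hYc.1; split.
  - by [].
  - exact: measurable_quantize_rv.
  (* The empty path has weight 1 and length 0, so its term is [D s] here and [b s] in the next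
     item. *)
  - move=> w w'; apply: le_trans (path_sum_source acE s po_ge0).
    rewrite /path_oscillation /path_weight big_nil mule1.
    exact: (quantize_rv_diam (iX s) n (hlaw s)).
  - apply: le_trans (path_sum_source acE s pe_ge0).
    rewrite /path_error /path_weight big_nil mule1 mulr0 mul0r mul0e adde0.
    exact: (quantize_rv_le_wasserstein (iX s) n (hlaw s)).
have IH (u : {u | u \in in_nbr E v}) : spec (val u).
  by apply: IHv; have := valP u; rewrite inE.
pose Z w := f v (fun u : {u : V | u \in in_nbr E v} => Yc (val u) w).
have YE : Y v = fun w => f v (fun u : {u | u \in in_nbr E v} => Y (val u) w).
  exact: hY.2.
have mY : measurable_fun setT (Y v).
  rewrite YE; apply: (measurable_lipschitz_comp (hf v vS)
    (Y := fun (u : {u | u \in in_nbr E v}) w => Y (val u) w)) => u.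
  by case: (IH u).
have mZ : measurable_fun setT Z.
  apply: (measurable_lipschitz_comp (hf v vS)
    (Y := fun (u : {u | u \in in_nbr E v}) w => Yc (val u) w)) => u.
  by case: (IH u).
have L0 : (0 <= (lip_norm (f v))%:E)%E by rewrite lee_fin lip_norm_ge0.
have ZD w w' : (`|Z w - Z w'|%:E <= path_sum (path_oscillation f D) v)%E.
  rewrite path_sum_oscillation//.
  apply: (@le_trans _ _ ((lip_norm (f v))%:E *
      (\sum_(u : {u | u \in in_nbr E v}) `|Yc (val u) w - Yc (val u) w'|)%:E)%E).
    by rewrite -EFinM lee_fin; exact: (lip_normP (hf v vS)).
  rewrite lee_wpmul2l// -sumEFin; apply: lee_sum => u _.
  by case: (IH u).
have [mC CD Cerr] := compress_rv_spec P n mZ ZD.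
rewrite /spec (hYc.2 v vS); split=> //.
(* The intermediate variable [Z] separates the errors inherited through [f v] from the error of
   compressing at [v]. *)
apply: le_trans (dist_integral_triangle P mY mZ mC) _.
rewrite path_sum_error//; apply: leeD.
  rewrite YE; apply: le_trans (expected_lipschitz (hf v vS) P
    (Y := fun (u : {u | u \in in_nbr E v}) w => Y (val u) w)
    (Y' := fun (u : {u | u \in in_nbr E v}) w => Yc (val u) w) _ _) _.
  - by move=> u; case: (IH u).
  - by move=> u; case: (IH u).
  by rewrite lee_wpmul2l//; apply: lee_sum => u _; case: (IH u).
(* Compression costs only [2 ^- n] times the oscillation bound, a third of what the path sum
   provides. *)
apply: le_trans Cerr _; rewrite lee_wpmul2r//; first exact: path_sum_ge0.
by rewrite lee_fin ler_peMl ?invr_ge0 ?exprn_ge0// ler1n.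
Qed.
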